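(* Let $[a,b]\subset\mathbb{R}$ be a compact interval. For all integers $n,d>0$ and $p\ge0$ consider the family $$\mathcal{F}^{(1)}_{n,p,d}=\Big\{f\in\mathcal{PD}(\mathfrak{D},p):\ \mathfrak{D}=\sum_{j=0}^{n}p_j(x)\partial^j,\ \alpha(\mathfrak{D})=d,\ p_n(x)\ne0\text{ on }[a,b]\Big\}$$ (the union over all such operators $\mathfrak{D}$ with real polynomial coefficients). Then $$\sigma\big(\mathcal{F}^{(1)}_{n,p,d}\big)\le(p+2)n+d-1.$$
   Context: $[a,b]$ is fixed. $\partial=d/dx$. For $\mathfrak{D}=\sum_{j=0}^np_j(x)\partial^j$ with real polynomial coefficients and $p_n\not\equiv0$, let $d_j=\deg p_j$ ($-\infty$ if $p_j\equiv0$), $\alpha_j=d_j-j$, and $\alpha(\mathfrak{D})=\max_{0\le j\le n}\alpha_j$. Class $\mathcal{PD}(\mathfrak{D},p)$: bounded piecewise-continuous functions $f:[a,b]\to\mathbb{R}$ with $a=\xi_0<\xi_1<\dots<\xi_p<\xi_{p+1}=b$ (depending on $f$), where $\xi_1,\dots,\xi_p$ are the interior points of discontinuity of $f$ and are of the first kind (jumps), and such that on each continuity interval $[\xi_j,\xi_{j+1}]$ $f$ (with one-sided limits as endpoint values) is $n$ times continuously differentiable ($n$ the order of $\mathfrak{D}$) and satisfies $\mathfrak{D}f=0$. Values at the $\xi_j$ are immaterial: $f\equiv0$ means $f$ vanishes off the $\xi_j$. Moments: $m_k(f)=\int_a^b x^kf(x)\,dx$, $k=0,1,2,\dots$. Moment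 vanishing index: $$\sigma(\mathfrak{D},p)=\sup_{f\in\mathcal{PD}(\mathfrak{D},p),\ f\not\equiv0}\{k:\ m_0(f)=\dots=m_k(f)=0\}+1,$$ with $\sigma(\mathfrak{D},p)=0$ if there are no such $f$ and $k\ge0$. For a family $\mathcal{F}$ of functions, $\sigma(\mathcal{F})=\sup\{\sigma(\mathfrak{D},p'):\ \mathcal{PD}(\mathfrak{D},p')\subset\mathcal{F}\}$. *)

(* Defs.v *)
(* MathComp world, with MathComp-Analysis. *)
From HB Require Import structures.
From mathcomp Require Import all_boot all_order all_algebra.
From mathcomp Require Import all_classical all_reals all_analysis.

Set Implicit Arguments.
Unset Strict Implicit.
Unset Printing Implicit Defensive.

Import Order.TTheory GRing.Theory Num.Theory.
Import numFieldNormedType.Exports.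

Local Open Scope classical_set_scope.
Local Open Scope ring_scope.

Record diffop (R : realType) := DiffOp {
  order : nat;
  coef : 'I_order.+1 -> {poly R};
  lead_neq0 : coef ord_max != 0 }.

Definition lead (R : realType) (D : diffop R) : {poly R} := coef (@ord_max (order D)).

Definition degree (R : realType) (q : {poly R}) : \bar int :=
  if q == 0 then -oo%E else ((size q).-1%:Z)%:E.

Definition alpha (R : realType) (D : diffop R) : \bar int :=
  \big[Order.max/-oo%E]_(j < (order D).+1) (degree (coef j) - (j%:Z)%:E)%E.

(* The derivative of g at x relative to I: one-sided at an endpoint of an
   interval I. *)
Definition has_deriv_within (R : realType) (I : set R) (g : R -> R) (x l : R) :=
  (fun y => (g y - g x) / (y - x)) @ within I x^' --> l.

(* g 0 is of class C^n on I, with successive derivatives g 1, ..., g n. *)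
Definition Cn_tower (R : realType) (I : set R) (n : nat) (g : nat -> R -> R) :=
  (forall i, (i <= n)%N -> {within I, continuous (g i)}) /\
  (forall i, (i < n)%N -> forall x, I x -> has_deriv_within I (g i) x (g i.+1 x)).

(* f, read on [u, v] with its one-sided limits as endpoint values, is of class
   C^n (n the order of D) and solves D f = 0 there.  The values f u and f v
   play no role: g 0 is the continuous extension of f from ]u, v[. *)
Definition solves_on (R : realType) (D : diffop R) (u v : R) (f : R -> R) :=
  exists g : nat -> R -> R,
    [/\ forall x, x \in `]u, v[ -> g 0%N x = f x,
        Cn_tower [set` `[u, v]] (order D) g
      & forall x, x \in `[u, v] ->
          \sum_(j < (order D).+1) (coef j).[x] * g j x = 0].

Definition jump_at (R : realType) (f : R -> R) (x : R) :=
  exists l r : R, [/\ f @ x^'- --> l, f @ x^'+ --> r & l != r].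

(* f belongs to the class with jump points xi 1 < ... < xi p.  Functions on
   [a, b] are represented by total functions; only xi 0, ..., xi p.+1 and the
   values of f on [a, b] matter. *)
Definition piecewise_sol (R : realType) (a b : R) (D : diffop R) (p : nat)
    (xi : nat -> R) (f : R -> R) :=
  [/\ [bounded f x | x in [set` `[a, b]]],
      xi 0%N = a /\ xi p.+1 = b,
      forall j, (j <= p)%N -> xi j < xi j.+1,
      forall j, (0 < j <= p)%N -> jump_at f (xi j)
    & forall j, (j <= p)%N -> solves_on D (xi j) (xi j.+1) f].

Definition PD (R : realType) (a b : R) (D : diffop R) (p : nat) : set (R -> R) :=
  [set f | exists xi, piecewise_sol a b D p xi f].

Definition moment (R : realType) (a b : R) (f : R -> R) (k : nat) : R :=
  \int[lebesgue_measure]_(x in `[a, b]) (x ^+ k * f x).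

Definition vanishes_off (R : realType) (a b : R) (p : nat) (xi : nat -> R)
    (f : R -> R) :=
  forall x, x \in `[a, b] -> (forall j, (j <= p.+1)%N -> x <> xi j) -> f x = 0.

Definition vanishing_orders (R : realType) (a b : R) (D : diffop R) (p : nat) :
    set nat :=
  [set k | exists f xi, [/\ piecewise_sol a b D p xi f,
      ~ vanishes_off a b p xi f
    & forall i, (i <= k)%N -> moment a b f i = 0]].

Definition sigma (R : realType) (a b : R) (D : diffop R) (p : nat) : \bar R :=
  if vanishing_orders a b D p == set0 then 0%E
  else (ereal_sup [set (k%:R)%:E | k in vanishing_orders a b D p] + 1)%E.

Definition sigma_family (R : realType) (a b : R) (F : set (R -> R)) : \bar R :=
  ereal_sup [set s | exists D p, PD a b D p `<=` F /\ s = sigma a b D p].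

Definition F1 (R : realType) (a b : R) (n p d : nat) : set (R -> R) :=
  [set f | exists D : diffop R,
    [/\ order D = n, alpha D = (d%:Z)%:E,
        forall x, x \in `[a, b] -> (lead D).[x] != 0
      & PD a b D p f]].

(* Main.v *)
(** If [q] is a polynomial, Lagrange's identity for [D] and integration over the
    pieces turn the integral of [(D^* q) f] over [[a, b]], which is a combination
    of the moments of order at most [deg q + d], into a sum of boundary terms at
    the [p + 2] points [xi i].  The term at [xi i] involves only the derivatives
    of [q] of order [< n] there.  Hence, when the moments vanish up to order
    [(p + 2) n + d - 1], test polynomials of degree [< (p + 2) n] vanishing to
    order [n] at all the points but one isolate the boundary term at that point:
    [f] has no jump at [xi 1], so there is no interior discontinuity, and the
    Cauchy data of [f] at [a] are zero, so [f] vanishes by uniqueness. *)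

Require Import Defs.
From HB Require Import structures.
From mathcomp Require Import all_boot all_order all_algebra.
From mathcomp Require Import all_classical all_reals all_analysis.
From mathcomp Require Import measurable_realfun zify ring lra.
Set Implicit Arguments.
Unset Strict Implicit.
Unset Printing Implicit Defensive.
Import Order.TTheory GRing.Theory Num.Theory.
Import numFieldNormedType.Exports.
Local Open Scope classical_set_scope.
Local Open Scope ring_scope.

(** * Derivatives of polynomials *)

Lemma size_derivn_leq (R : nzRingType) (q : {poly R}) (m : nat) :
  (size q^`(m) <= size q - m)%N.
Proof.
elim: m => [|m IHm]; first by rewrite subn0.
rewrite derivnS subnS; apply: leq_trans (size_poly _ _) _.
by rewrite -!subn1 leq_sub2r.
Qed.

(** One factor is lost and the new cofactor stays explicit. Its value [m.+1 * r.[x]] at [x] is what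
    produces the factorial in [concomitant_lead]. *)
Lemma deriv_XsubC_expM (R : comNzRingType) (x : R) (m : nat) (r : {poly R}) :
  (('X - x%:P) ^+ m.+1 * r)^`() =
  ('X - x%:P) ^+ m * (r *+ m.+1 + ('X - x%:P) * r^`()).
Proof.
rewrite derivM deriv_exp derivXsubC mul1r /= mulrDr.
by rewrite mulrnAl mulrnAr mulrA -exprSr.
Qed.

(** * Boundary terms of repeated integration by parts *)

Section Concomitant.
Context {R : realType}.
Implicit Types (g : nat -> R -> R) (h r : {poly R}) (x : R).

(* The boundary terms left by j integrations by parts of [h * g j], where
   [g i.+1] is the derivative of [g i]. *)
Fixpoint concomitant g j h x : R :=
  if j is i.+1 then h.[x] * g i x - concomitant g i h^`() x else 0.

(** Up to sign, the terms are the i-th derivative of the polynomial times [g (j - 1 - i)]. At [x]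
    the first factor is zero for [i < m], the second for [i >= m]. *)
Lemma concomitant_eq0 g x m s j r :
    (forall i, (i < s)%N -> g i x = 0) -> (j <= m + s)%N ->
  concomitant g j (('X - x%:P) ^+ m * r) x = 0.
Proof.
move=> g0; elim: j m r => [//|j IHj] [|m] r jms /=.
  rewrite g0 ?mulr0 ?sub0r; last by rewrite -ltnS.
  by rewrite expr0 mul1r -[r^`()]mul1r -(expr0 ('X - x%:P)) IHj ?oppr0 // ltnW.
rewrite hornerM horner_exp hornerXsubC subrr expr0n /= !mul0r sub0r.
rewrite deriv_XsubC_expM.
by rewrite IHj ?oppr0.
Qed.

(** Only the term with [m] derivatives on the polynomial survives: this derivative is [m!] times
    [r.[x]] at [x], and it is paired with [g s]. *)
Lemma concomitant_lead g x m s r :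
    (forall i, (i < s)%N -> g i x = 0) ->
  concomitant g (m + s).+1 (('X - x%:P) ^+ m * r) x =
  (-1) ^+ m * (m`!%:R * r.[x] * g s x).
Proof.
move=> g0; elim: m r => [|m IHm] r.
  rewrite /= expr0 !mul1r -[r^`()]mul1r -(expr0 ('X - x%:P)).
  by rewrite (@concomitant_eq0 _ _ 0 s) ?subr0.
rewrite addSn [LHS]/=.
rewrite hornerM horner_exp hornerXsubC subrr expr0n /= !mul0r sub0r.
rewrite deriv_XsubC_expM.
have := IHm (r *+ m.+1 + ('X - x%:P) * r^`()).
rewrite [concomitant _ _ _ _]/= => ->.
rewrite hornerD hornerM hornerXsubC subrr mul0r addr0 hornerMn.
by rewrite factS natrM exprS -mulr_natl; ring.
Qed.

Lemma has_deriv_within_is_derive (I : set R) (f : R -> R) (x l : R) :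
  (\forall y \near x, I y) -> has_deriv_within I f x l -> is_derive x 1 f l.
Proof.
move=> Ix fl.
have : (fun k : R => k^-1 *: ((f \o shift x) (k *: 1) - f x)) @ 0^' --> l.
  move=> A /fl /nbhs0P nA; move/nbhs0P: Ix => nI.
  rewrite /nbhs /= /dnbhs /within /=; apply: filterS2 nA nI => k kA kI k0.
  have -> : k^-1 *: (f (k *: 1 + x) - f x) = (f (x + k) - f x) / (x + k - x).
    by rewrite [k *: 1]mulr1 [k + x]addrC [x + k - x]addrC addKr mulrC.
  by apply: kA => //; rewrite -subr_eq0 [x + k]addrC addrK.
move=> fl'; split; first by apply/cvg_ex; exists l.
exact: cvg_lim fl'.
Qed.

(** Lagrange's identity for a single term: the mixed products telescope and the two extreme ones
    remain. *)
Lemma is_derive_concomitant g n j h x :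
    (forall i, (i < n)%N -> is_derive x 1 (g i) (g i.+1 x)) -> (j <= n)%N ->
  is_derive x 1 (concomitant g j h)
    (h.[x] * g j x - (-1) ^+ j * h^`(j).[x] * g 0 x).
Proof.
move=> dg; elim: j h => [|j IHj] h jn.
  by rewrite expr0 mul1r subrr; exact: is_derive_cst.
have dh := is_derive_poly h x.
have := is_deriveB (is_deriveM dh (dg j jn)) (IHj h^`() (ltnW jn)).
move=> /is_derive_eq; apply.
by rewrite -derivSn exprS /GRing.scale /=; ring.
Qed.

Lemma continuous_concomitant (I : set R) g n j h :
    (forall i, (i < n)%N -> {within I, continuous (g i)}) -> (j <= n)%N ->
  {within I, continuous (concomitant g j h)}.
Proof.
move=> cg; elim: j h => [|j IHj] h jn; first by move=> x; exact: cvg_cst.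
have ch : {within I, continuous (horner h)}.
  by apply: continuous_subspaceT => x; exact: continuous_horner.
move=> x; have := continuousM (ch x) (cg _ jn x).
by move=> /cvgB; apply; exact: IHj (ltnW jn) x.
Qed.

End Concomitant.

(** * Lagrange's identity integrated over one piece *)

Section Lagrange.
Context {R : realType}.
Implicit Types (D : diffop R) (q : {poly R}) (g : nat -> R -> R).

Lemma within_continuous_sum (T : topologicalType) (A : set T) n
    (F : 'I_n -> T -> R) :
  (forall i, {within A, continuous (F i)}) ->
  {within A, continuous (fun x => \sum_(i < n) F i x)}.
Proof.
by move=> cF; apply: (continuous_big (@add_continuous R)) => i _; exact: cF.
Qed.

Definition adjoint D q : {poly R} :=
  \sum_(j < (Defs.order D).+1) (-1) ^+ j *: (coef j * q)^`(j).

(** The bilinear concomitant of Lagrange's identity: its derivative is [q] times [D g] minus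
    [adjoint D q] times [g 0]. *)
Definition boundary_form D g q (x : R) : R :=
  \sum_(j < (Defs.order D).+1) concomitant g j (coef j * q) x.

(** Since [D g = 0], minus the boundary form is a primitive of the integrand inside the interval,
    and it is continuous up to the endpoints. *)
Lemma Rintegral_adjoint D q g (u v : R) : u < v ->
    Cn_tower `[u, v] (Defs.order D) g ->
    (forall x, x \in `[u, v] ->
      \sum_(j < (Defs.order D).+1) (coef j).[x] * g j x = 0) ->
  \int[lebesgue_measure]_(x in `[u, v]) ((adjoint D q).[x] * g 0 x) =
  boundary_form D g q u - boundary_form D g q v.
Proof.
move=> uv [cg dg] ode.
have cB : {within `[u, v], continuous (boundary_form D g q)}.
  apply: (@within_continuous_sum _ _ _
    (fun j : 'I_(Defs.order D).+1 => concomitant g j (coef j * q))) => j.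
  exact: (continuous_concomitant (fun i iD => cg i (ltnW iD)) (ltn_ord j)).
have dB x : x \in `]u, v[ ->
    is_derive x 1 (- boundary_form D g q) ((adjoint D q).[x] * g 0 x).
  move=> xuv; have xI : [set` `[u, v]] x by exact: subset_itv_oo_cc.
  have nI : \forall y \near x, [set` `[u, v]] y.
    by near=> y; apply: subset_itv_oo_cc; near: y; exact: near_in_itvoo.
  have dgx i : (i < Defs.order D)%N -> is_derive x 1 (g i) (g i.+1 x).
    by move=> iD; apply: has_deriv_within_is_derive nI _; exact: dg.
  have dsum := is_derive_sum (fun j : 'I_(Defs.order D).+1 =>
    is_derive_concomitant (coef j * q) dgx (ltn_ord j)).
  have -> : boundary_form D g q =
      \sum_(j < (Defs.order D).+1) concomitant g j (coef j * q).
    by apply/funext => y; rewrite fct_sumE.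
  have := is_deriveN dsum; move=> /is_derive_eq; apply.
  rewrite sumrB opprB /adjoint horner_sum mulr_suml.
  under [X in _ - X]eq_bigr do rewrite hornerM mulrAC mulrC.
  rewrite -mulr_sumr ode ?mulr0 ?subr0 //.
  by apply: eq_bigr => j _; rewrite hornerZ.
rewrite /Rintegral (@continuous_FTC2 _ _ (- boundary_form D g q)) //.
- by rewrite -EFinB /= opprK addrC.
- move=> x; apply: continuousM; last exact: cg.
  by apply: continuous_subspaceT => {}x; exact: continuous_horner.
- have [_ ca cb] := (continuous_within_itvP _ uv).1 cB.
  by split=> [x xuv||]; [case: (dB x xuv) | exact: cvgN | exact: cvgN].
- by move=> x xuv; rewrite derive1E; case: (dB x xuv).
Unshelve. all: by end_near. Qed.

End Lagrange.

(** * Gluing the pieces: measurability and integrals *)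

Section Pieces.
Context {R : realType}.
Variables (xi : nat -> R) (G : nat -> R -> R) (f : R -> R).
Notation mu := lebesgue_measure.

(** Half-open intervals concatenate without overlap. The inequality is carried along because the
    induction step splits the interval at [xi k]. *)
Lemma measurable_fun_pieces k :
    (forall j, (j < k)%N -> xi j < xi j.+1) ->
    (forall j, (j < k)%N -> {within `[xi j, xi j.+1], continuous (G j)}) ->
    (forall j, (j < k)%N -> {in `]xi j, xi j.+1[, G j =1 f}) ->
  xi 0 <= xi k /\ measurable_fun `[xi 0, xi k[ f.
Proof.
elim: k => [|k IHk] ltxi cG Gf.
  by split=> //; rewrite set_itvco0; exact: measurable_fun_set0.
have [||| le0k mf] := IHk.
- by move=> j /ltnW; exact: ltxi.
- by move=> j /ltnW; exact: cG.
- by move=> j /ltnW; exact: Gf.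
have ltk := ltxi k (ltnSn k); split; first exact: le_trans le0k (ltW ltk).
rewrite (@itv_bndbnd_setU _ _ _ (BLeft (xi k))) ?bnd_simp ?(ltW ltk)//.
apply/measurable_funU => //; split=> //.
(* The value [f (xi k)] is arbitrary, but a single point does not affect measurability. *)
apply/measurable_fun_itv_obnd_cbndP.
apply: (@eq_measurable_fun _ _ _ _ _ (G k)).
  by move=> x; rewrite inE; exact: Gf.
apply: (@measurable_funS _ _ _ _ `[xi k, xi k.+1]) => //.
  exact: subset_itv_oo_cc.
by apply: subspace_continuous_measurable_fun => //; exact: cG.
Qed.

(** Nodes have measure zero, so on each piece [f] may be replaced by its continuous extension
    [G j]. *)
Lemma Rintegral_pieces k :
    (forall j, (j < k)%N -> xi j < xi j.+1) ->
    (forall j, (j < k)%N -> {within `[xi j, xi j.+1], continuous (G j)}) ->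
    (forall j, (j < k)%N -> {in `]xi j, xi j.+1[, G j =1 f}) ->
    mu.-integrable `[xi 0, xi k[ (EFin \o f) ->
  \int[mu]_(x in `[xi 0, xi k[) f x =
  \sum_(j < k) \int[mu]_(x in `[xi j, xi j.+1]) G j x.
Proof.
elim: k => [|k IHk] ltxi cG Gf fint.
  by rewrite big_ord0 set_itvco0 Rintegral_set0.
have ltxi' j : (j < k)%N -> xi j < xi j.+1 by move=> /ltnW; exact: ltxi.
have cG' j : (j < k)%N -> {within `[xi j, xi j.+1], continuous (G j)}.
  by move=> /ltnW; exact: cG.
have Gf' j : (j < k)%N -> {in `]xi j, xi j.+1[, G j =1 f}.
  by move=> /ltnW; exact: Gf.
have ltk := ltxi k (ltnSn k).
have [le0k _] := measurable_fun_pieces ltxi' cG' Gf'.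
have splitE : `[xi 0, xi k.+1[%classic = `[xi 0, xi k[ `|` `[xi k, xi k.+1[.
  by rewrite (@itv_bndbnd_setU _ _ _ (BLeft (xi k))) ?bnd_simp ?(ltW ltk).
rewrite big_ord_recr /= -IHk //; last first.
  by apply: integrableS fint => //; rewrite splitE; exact: subsetUl.
have fint2 : mu.-integrable `]xi k, xi k.+1[ (EFin \o f).
  apply: integrableS fint => //; rewrite splitE.
  by apply: subset_trans (@subsetUr _ _ _); apply: subset_itv; rewrite ?bnd_simp.
have Gint : mu.-integrable `[xi k, xi k.+1] (EFin \o G k).
  by apply: continuous_compact_integrable; [exact: segment_compact | exact: cG].
rewrite splitE Rintegral_setU -?splitE //; last first.
  apply/disj_setPS => x [/=]; rewrite !in_itv /= => /andP[_ xk] /andP[kx _].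
  by move: xk; rewrite ltNge kx.
congr (_ + _); rewrite -(Rintegral_itv_obnd_cbnd fint2).
transitivity (\int[mu]_(x in `]xi k, xi k.+1[) G k x).
  by apply: eq_Rintegral => x; rewrite inE => /Gf ->.
rewrite Rintegral_itv_bndo_bndc ?Rintegral_itv_obnd_cbnd //.
  by apply: integrableS Gint => //; exact: subset_itv_oc_cc.
by apply: integrableS Gint => //; exact: subset_itv_oo_cc.
Qed.

End Pieces.

(** * Uniqueness for the Cauchy problem *)

Section Uniqueness.
Context {R : realType}.
Variables (D : diffop R) (g : nat -> R -> R) (u v : R).
Notation n := (Defs.order D).
Hypothesis tower : Cn_tower `[u, v] n g.
Hypothesis ode : forall x, x \in `[u, v] ->
  \sum_(j < n.+1) (coef j).[x] * g j x = 0.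
Hypothesis lead0 : forall x, x \in `[u, v] -> (lead D).[x] != 0.
Hypothesis initial0 : forall i, (i < n)%N -> g i u = 0.

Let energy x := \sum_(i < n) g i x ^+ 2.

Let energy_ge (i : 'I_n) x : g i x ^+ 2 <= energy x.
Proof.
rewrite /energy (bigD1 i) //= lerDl.
by apply: sumr_ge0 => j _; exact: sqr_ge0.
Qed.

(** Follows from the squares of the sum and of the difference. The factor 2 on the right lets the
    bound cover [i = j] as well. *)
Let prod_le_energy (i j : 'I_n) x : `|g i x * g j x *+ 2| <= energy x *+ 2.
Proof.
have := energy_ge i x; have := energy_ge j x; rewrite ler_norml.
have := sqr_ge0 (g i x - g j x); have := sqr_ge0 (g i x + g j x).
by move=> *; apply/andP; split; nra.
Qed.

(** The quotients are the coefficients of the equation solved for its highest derivative; they are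
    continuous on a compact interval, as [lead D] has no zero there. *)
Let normal_coef_bounded : u <= v ->
  exists C : R, forall x, x \in `[u, v] ->
    \sum_(j < n) `|(coef (widen_ord (leqnSn n) j)).[x] / (lead D).[x]| <= C.
Proof.
move=> uv; pose F x : R := \sum_(j < n)
  `|(coef (widen_ord (leqnSn n) j)).[x] / (lead D).[x]|.
have cF : {within `[u, v], continuous F}.
  apply: (@within_continuous_sum _ _ _ _ (fun j : 'I_n => fun x =>
    `|(coef (widen_ord (leqnSn n) j)).[x] / (lead D).[x]|)) => j.
  apply: continuous_in_subspaceT => x; rewrite inE => xuv.
  apply: (@continuous_comp _ _ _ (fun z =>
    (coef (widen_ord (leqnSn n) j)).[z] / (lead D).[z]) Num.norm) => /=;
    last exact: norm_continuous.
  apply: continuousM; first exact: continuous_horner.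
  by apply: continuousV; [exact: lead0 | exact: continuous_horner].
by have [c _ Fc] := EVT_max uv cF; exists (F c).
Qed.

(* Gronwall: the energy [E] satisfies [E' <= K * E], so [E * exp (- K x)] is
   nonincreasing. *)
Lemma ode_unique x : x \in `[u, v] -> (0 < n)%N -> g 0 x = 0.
Proof.
have [cg dg] := tower.
move=> xuv n_gt0; have [ux xv] : u <= x /\ x <= v.
  by move: xuv; rewrite in_itv => /andP.
have [C CP] := normal_coef_bounded (le_trans ux xv).
(* One share [2 + 2 * C] for each of the [n] summands of the derivative of [energy]: [2] covers
   those with [i.+1 < n], and [2 * C] the last one, where the equation replaces [g n]. *)
pose K : R := (2 + 2 * C) *+ n.
pose weight : R -> R := expR \o horner (- K *: 'X).
pose F y := energy y * weight y.
have energy_ge0 y : 0 <= energy y.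
  by apply: sumr_ge0 => i _; exact: sqr_ge0.
have C_ge0 : 0 <= C.
  by apply: le_trans (CP _ xuv); apply: sumr_ge0.
have dE y : y \in `]u, v[ ->
    is_derive y 1 energy (\sum_(i < n) g i y * g i.+1 y *+ 2).
  move=> yuv; have yI : [set` `[u, v]] y by exact: subset_itv_oo_cc.
  have nI : \forall z \near y, [set` `[u, v]] z.
    by near=> z; apply: subset_itv_oo_cc; near: z; exact: near_in_itvoo.
  have dgy (i : 'I_n) : is_derive y 1 (g i) (g i.+1 y).
    by apply: has_deriv_within_is_derive nI _; exact: dg.
  have -> : energy = \sum_(i < n) (g i : R -> R) ^+ 2.
    by apply/funext => z; rewrite fct_sumE.
  have := is_derive_sum (fun i => is_deriveX 2 (dgy i)).
  move=> /is_derive_eq; apply.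
  by apply: eq_bigr => i _; rewrite /GRing.scale /= expr1 mulr_natl mulrnAl.
have dW (y : R) : is_derive y 1 weight (weight y * - K).
  have := is_derive1_comp (is_derive_expR _) (is_derive_poly (- K *: 'X) y).
  by rewrite derivZ derivX hornerZ hornerC mulr1.
have dF y : y \in `]u, v[ -> is_derive y 1 F
    ((\sum_(i < n) g i y * g i.+1 y *+ 2 - K * energy y) * weight y).
  move=> yuv; apply: is_derive_eq (is_deriveM (dE y yuv) (dW y)) _.
  by rewrite /GRing.scale /=; ring.
have cF : {within `[u, v], continuous F}.
  move=> y; apply: continuousM.
    move: y; apply: (@within_continuous_sum _ _ _ _
      (fun i : 'I_n => fun y => g i y ^+ 2)).
    move=> i y; apply: continuousM; exact: cg (ltnW (ltn_ord i)) y.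
  apply: continuous_subspaceT => {}y; apply: continuous_comp.
    exact: continuous_horner.
  exact: continuous_expR.
have uuv : u \in `[u, v] by rewrite in_itv /= lexx (le_trans ux xv).
have Fle : F x <= F u.
  apply: (ler0_derive1_le_cc _ _ cF) => //; first by move=> y /dF [].
  move=> y yuv; rewrite derive1E; have [_ ->] := dF _ yuv.
  rewrite pmulr_lle0 ?expR_gt0 // subr_le0.
  have yI : y \in `[u, v] by exact: subset_itv_oo_cc.
  rewrite /K -mulr_natl -mulrA mulr_natl -[in leRHS](card_ord n) -sumr_const.
  apply: ler_sum => i _.
  have [iSn|] := ltnP i.+1 n.
    have := prod_le_energy i (Ordinal iSn) y => /=; rewrite ler_norml => /andP[_].
    have := mulr_ge0 C_ge0 (energy_ge0 y).
    by move=> *; lra.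
  move=> nSi; have {nSi} -> : i.+1 = n by apply/eqP; rewrite eqn_leq nSi ltn_ord.
  have gn : g n y = - \sum_(j < n)
      (coef (widen_ord (leqnSn n) j)).[y] / (lead D).[y] * g j y.
    have ly : (lead D).[y] != 0 by exact: lead0.
    apply: (mulfI ly); move/eqP: (ode yI).
    rewrite big_ord_recr /= addrC addr_eq0 => /eqP ->.
    rewrite mulrN mulr_sumr; congr (- _); apply: eq_bigr => j _.
    by rewrite [in RHS]mulrA [_ * (_ / _)]mulrC divfK.
  rewrite gn mulrN mulr_sumr mulNrn -sumrMnl -sumrN.
  apply: (@le_trans _ _ (C * (energy y *+ 2))); last first.
    by have := energy_ge0 y; lra.
  apply: le_trans (ler_wpM2r _ (CP _ yI)); last by rewrite mulrn_wge0.
  rewrite mulr_suml; apply: ler_sum => j _.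
  apply: le_trans (ler_norm _) _.
  by rewrite normrN mulrCA -mulrnAr normrM ler_wpM2l.
have : F u = 0.
  by rewrite /F /energy big1 ?mul0r // => i _; rewrite initial0 ?expr0n.
move=> Fu; move: Fle; rewrite Fu pmulr_lle0 ?expR_gt0 // => E0.
have := energy_ge (Ordinal n_gt0) x; rewrite /= => /le_trans /(_ E0).
by rewrite le_eqVlt ltNge sqr_ge0 orbF sqrf_eq0 => /eqP.
Unshelve. all: by end_near. Qed.

End Uniqueness.

(** * Test polynomials with prescribed zeros at the nodes *)

Section Nodes.
Context {R : realType}.
Variables (xi : nat -> R) (p : nat).

(** With [m] the order of [D], the boundary terms at all nodes but [xi i] vanish, and [e] selects
    the derivative probed at [xi i]. For [e < m] the degree is below [(p + 2) * m]. *)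
Definition node_poly i e m : {poly R} :=
  ('X - (xi i)%:P) ^+ e * \prod_(l < p.+2 | val l != i) ('X - (xi l)%:P) ^+ m.

Lemma size_node_poly i e m : (i < p.+2)%N ->
  (size (node_poly i e m) <= e + p.+1 * m + 1)%N.
Proof.
move=> ip; apply: leq_trans (size_polyMleq _ _) _.
rewrite size_exp_XsubC addSn /= -addnA leq_add2l.
apply: leq_trans (size_poly_prod_leq _ _) _.
under eq_bigr do rewrite size_exp_XsubC.
have cardE : #|(fun l : 'I_p.+2 => val l != i)| = p.+1.
  apply: etrans (etrans (cardC1 (Ordinal ip)) _); last by rewrite card_ord.
  exact: eq_card.
rewrite sum_nat_const cardE.
by rewrite mulnS -addnS addKn addn1.
Qed.

Lemma node_poly_factor i e m l : (l < p.+2)%N -> l != i ->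
  exists r, node_poly i e m = ('X - (xi l)%:P) ^+ m * r.
Proof.
move=> lp li; rewrite /node_poly (bigD1 (Ordinal lp)) //=.
by eexists; rewrite mulrCA.
Qed.

Lemma lt_nodes : (forall j, (j <= p)%N -> xi j < xi j.+1) ->
  forall i j, (i < j)%N -> (j < p.+2)%N -> xi i < xi j.
Proof.
move=> ltxi i j ij jp.
apply: (@homo_ltn_in _ [pred k | k < p.+2]%N xi (fun x y => x < y)) => //=.
- by move=> y x z; exact: lt_trans.
- by move=> k l _ lp m /andP[_ /ltn_trans]; apply.
- by move=> k _; rewrite inE ltnS => /ltxi.
by rewrite inE; exact: ltn_trans ij jp.
Qed.

Lemma le_nodes : (forall j, (j <= p)%N -> xi j < xi j.+1) ->
  forall i j, (i <= j)%N -> (j < p.+2)%N -> xi i <= xi j.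
Proof.
move=> ltxi i j; rewrite leq_eqVlt => /orP[/eqP -> //|ij jp].
exact/ltW/lt_nodes.
Qed.

End Nodes.

(** * The boundary form at a zero of the test polynomial *)

Section BoundaryForm.
Context {R : realType}.
Variables (D : diffop R) (g : nat -> R -> R).
Notation n := (Defs.order D).

Lemma boundary_form_eq0 x r : boundary_form D g (('X - x%:P) ^+ n * r) x = 0.
Proof.
rewrite /boundary_form big1 // => j _; rewrite mulrCA.
by rewrite (@concomitant_eq0 _ _ _ n 0) // addn0 -ltnS.
Qed.

(** The summands with [j < n] vanish because [j <= m + s]; the one with [j = n] brings in the
    leading coefficient. *)
Lemma boundary_form_lead x m s r : (m + s).+1 = n ->
    (forall i, (i < s)%N -> g i x = 0) ->
  boundary_form D g (('X - x%:P) ^+ m * r) x =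
  (-1) ^+ m * (m`!%:R * ((lead D).[x] * r.[x]) * g s x).
Proof.
move=> msn g0; rewrite /boundary_form big_ord_recr /= big1 ?add0r.
  by rewrite -/(lead D) mulrCA -msn concomitant_lead // hornerM.
by move=> j _; rewrite mulrCA (@concomitant_eq0 _ _ _ m s) // -ltnS msn.
Qed.

End BoundaryForm.

(** * From vanishing moments to a vanishing solution *)

Definition local_solutions {R : realType} (D : diffop R) p (xi : nat -> R)
    (f : R -> R) (G : nat -> nat -> R -> R) :=
  forall j, (j <= p)%N ->
  [/\ forall x, x \in `]xi j, xi j.+1[ -> G j 0%N x = f x,
      Cn_tower `[xi j, xi j.+1] (Defs.order D) (G j)
    & forall x, x \in `[xi j, xi j.+1] ->
        \sum_(k < (Defs.order D).+1) (coef k).[x] * G j k x = 0].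

Section PiecewiseSolution.
Context {R : realType}.
Variables (a b : R) (D : diffop R) (p : nat) (xi : nat -> R) (f : R -> R).
Hypothesis sol : piecewise_sol a b D p xi f.
Notation n := (Defs.order D).
Notation mu := lebesgue_measure.

Let ltxi : forall j, (j <= p)%N -> xi j < xi j.+1.
Proof. by case: sol. Qed.

Let aE : xi 0 = a. Proof. by case: sol => _ []. Qed.
Let bE : xi p.+1 = b. Proof. by case: sol => _ []. Qed.

Let node_itv i : (i < p.+2)%N -> xi i \in `[a, b].
Proof.
by move=> ip; rewrite -aE -bE in_itv /= !(le_nodes ltxi).
Qed.

Lemma itv_node j x : (j <= p)%N -> x \in `[xi j, xi j.+1] -> x \in `[a, b].
Proof.
move=> jp; rewrite !in_itv /= => /andP[jx xj].
have := node_itv (leqW jp); have := @node_itv j.+1 jp; rewrite !in_itv /=.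
by move=> /andP[_ jb] /andP[aj _]; rewrite (le_trans aj jx) (le_trans xj jb).
Qed.

Lemma exists_local_solutions : exists G, local_solutions D p xi f G.
Proof.
have [_ _ _ _ loc] := sol.
suff /choice[G GP] : forall j, exists g : nat -> R -> R, (j <= p)%N ->
    [/\ forall x, x \in `]xi j, xi j.+1[ -> g 0 x = f x,
      Cn_tower `[xi j, xi j.+1] n g
    & forall x, x \in `[xi j, xi j.+1] ->
        \sum_(k < n.+1) (coef k).[x] * g k x = 0] by exists G.
move=> j; have [/loc[g gP]|_] := leqP j p; first by exists g.
(* [choice] asks for a tower at every index; past the last piece zero is an arbitrary filler. *)
by exists (fun _ _ => 0).
Qed.

(** [f] is bounded by definition of the class and measurable by gluing; a polynomial is bounded on a
    compact interval. *)
Let poly_integrable (r : {poly R}) :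
  mu.-integrable `[a, b] (EFin \o (fun x => r.[x] * f x)).
Proof.
have [G GP] := exists_local_solutions.
have [bf _ _ _ _] := sol.
have cr : {within `[a, b], continuous (horner r)}.
  by apply: continuous_subspaceT => x; exact: continuous_horner.
have [_ mf] : xi 0 <= xi p.+1 /\ measurable_fun `[xi 0, xi p.+1[ f.
  apply: (measurable_fun_pieces (G := fun j => G j 0)) => j jp.
  - exact: ltxi.
  - by have [_ [cG _] _] := GP j jp; exact: cG.
  - by have [Gf _ _] := GP j jp; exact: Gf.
rewrite aE bE in mf.
have fint : mu.-integrable `[a, b] (EFin \o f).
  apply: measurable_bounded_integrable => //.
    by rewrite /= lebesgue_measure_itv /=; case: ifP; rewrite ?ltry.
  exact/measurable_fun_itv_bndo_bndcP.
apply: (@integrableMr _ _ _ mu _ _ (horner r) (EFin \o f)) => //.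
  exact: subspace_continuous_measurable_fun.
have /compact_bounded : compact (horner r @` `[a, b]).
  by apply: continuous_compact; [exact: cr | exact: segment_compact].
rewrite /= /bounded_near; apply: filterS => M rM x xab.
by apply: rM; exists x.
Qed.

Lemma Rintegral_moment (r : {poly R}) :
  \int[mu]_(x in `[a, b]) (r.[x] * f x) =
  \sum_(i < size r) r`_i * moment a b f i.
Proof.
under eq_Rintegral do rewrite horner_coef mulr_suml.
(* Induction on the number of terms, the coefficients remaining those of the fixed [r]. *)
elim: (size r) => [|m IHm].
  under eq_Rintegral do rewrite big_ord0.
  by rewrite big_ord0 Rintegral_cst // mul0r.
under eq_Rintegral do rewrite big_ord_recr /=.
rewrite big_ord_recr /= RintegralD //.
- rewrite IHm; congr (_ + _); rewrite /moment.
  under eq_Rintegral do rewrite -mulrA.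
  rewrite RintegralZl //.
  have := poly_integrable 'X^m.
  by apply: eq_integrable => // x _ /=; rewrite hornerXn.
- have := poly_integrable (\sum_(i < m) r`_i *: 'X^i).
  apply: eq_integrable => // x _ /=; congr EFin; rewrite horner_sum mulr_suml.
  by apply: eq_bigr => i _; rewrite hornerZ hornerXn.
- have := poly_integrable (r`_m *: 'X^m).
  by apply: eq_integrable => // x _ /=; rewrite hornerZ hornerXn.
Qed.

Variable d k : nat.
Hypothesis n_gt0 : (0 < n)%N.
Hypothesis lead0 : forall x, x \in `[a, b] -> (lead D).[x] != 0.
Hypothesis size_coef : forall j : 'I_n.+1, (size (coef j) <= d + j + 1)%N.
Hypothesis moment0 : forall i, (i <= k)%N -> moment a b f i = 0.
Hypothesis k_large : ((p + 2) * n + d <= k.+1)%N.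

(** Multiplication by [coef j] raises the degree by at most [d + j], and the [j] derivations take
    back [j]. *)
Lemma size_adjoint q : (size (adjoint D q) <= size q + d)%N.
Proof.
apply: leq_trans (size_sum _ _ _) _; apply/bigmax_leqP => j _.
apply: leq_trans (size_scale_leq _ _) _.
apply: leq_trans (size_derivn_leq _ _) _.
rewrite leq_subLR; apply: leq_trans (size_polyMleq _ _) _.
by have := size_coef j; move: (size (coef j)) (size q) => x y; lia.
Qed.

(** [adjoint D q] has size at most [k.+1], so its integral against [f] combines vanishing moments
    only; cut at the nodes, this integral is the sum of boundary terms. *)
Lemma sum_boundary_form G (q : {poly R}) : local_solutions D p xi f G ->
    (size q <= (p + 2) * n)%N ->
  \sum_(j < p.+1) (boundary_form D (G j) q (xi j) -
                   boundary_form D (G j) q (xi j.+1)) = 0.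
Proof.
move=> GP sq.
have : \int[mu]_(x in `[a, b]) ((adjoint D q).[x] * f x) = 0.
  rewrite Rintegral_moment big1 // => i _; rewrite moment0 ?mulr0 //.
  rewrite -ltnS; apply: leq_trans (ltn_ord i) (leq_trans (size_adjoint q) _).
  by apply: leq_trans k_large; rewrite leq_add2r.
have adjint := poly_integrable (adjoint D q).
rewrite -Rintegral_itv_bndo_bndc; last first.
  by apply: integrableS adjint => //; exact: subset_itv_co_cc.
rewrite -aE -bE.
rewrite (Rintegral_pieces (G := fun j x => (adjoint D q).[x] * G j 0 x)).
- move=> sum0; rewrite -[RHS]sum0; apply: eq_bigr => j _.
  have [_ tG ode] := GP j (ltn_ord j).
  by rewrite (Rintegral_adjoint q (ltxi (ltn_ord j)) tG ode).
- by move=> j jp; exact: ltxi.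
- move=> j jp x; have [_ [cG _] _] := GP j jp.
  apply: continuousM; last exact: cG.
  by apply: continuous_subspaceT => {}x; exact: continuous_horner.
- by move=> j jp x xj; have [-> //] := GP j jp.
- by rewrite aE bE; apply: integrableS adjint => //; exact: subset_itv_co_cc.
Qed.

Lemma cofactor_neq0 i m : (i < p.+2)%N ->
  (\prod_(l < p.+2 | val l != i) ('X - (xi l)%:P) ^+ m).[xi i] != 0.
Proof.
move=> ip; rewrite horner_prod; apply/prodf_neq0 => l li.
rewrite horner_exp hornerXsubC expf_neq0 // subr_eq0.
have lp := ltn_ord l; move: li; rewrite neq_ltn => /orP[li|il].
  by rewrite gt_eqF // (lt_nodes ltxi).
by rewrite lt_eqF // (lt_nodes ltxi).
Qed.

Lemma boundary_form_other_node g i e l : (l < p.+2)%N -> l != i ->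
  boundary_form D g (node_poly xi p i e n) (xi l) = 0.
Proof.
move=> lp li; have [r ->] := node_poly_factor xi e n lp li.
exact: boundary_form_eq0.
Qed.

Lemma size_test_poly i e : (i < p.+2)%N -> (e < n)%N ->
  (size (node_poly xi p i e n) <= (p + 2) * n)%N.
Proof.
move=> ip en; apply: leq_trans (size_node_poly _ _ _ ip) _.
by rewrite addn2 mulSn addn1 -addSn leq_add2r.
Qed.

(* Testing with a zero of order exactly [n - 1 - s] at [xi 0] isolates the
   derivative of order [s] once the lower ones are known to vanish. *)
Lemma initial_values0 G : local_solutions D p xi f G ->
  forall s, (s < n)%N -> G 0 s (xi 0) = 0.
Proof.
move=> GP s; have [m] := ubnP s; elim: m s => // m IHm s; rewrite ltnS => sm sn.
have g0 i : (i < s)%N -> G 0 i (xi 0) = 0.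
  by move=> is_; apply: IHm; [exact: leq_trans is_ sm | exact: ltn_trans is_ sn].
have msn : ((n - s.+1) + s).+1 = n by rewrite -addnS subnK.
have en : (n - s.+1 < n)%N by rewrite -[ltnRHS]msn ltnS leq_addr.
have := sum_boundary_form GP (size_test_poly (ltn0Sn _) en).
(* The test polynomial kills the terms at every node but [xi 0], which is an endpoint of the first
   piece alone. *)
rewrite big_ord_recl big1 => [|j _]; last first.
  have jp := ltn_ord j.
  by rewrite !boundary_form_other_node ?subrr //= /bump leq0n; lia.
rewrite addr0 (boundary_form_other_node _ _ (l := 1)) // subr0.
rewrite /node_poly (boundary_form_lead _ msn g0) => /eqP.
rewrite !mulf_eq0 signr_eq0 pnatr_eq0 (gtn_eqF (fact_gt0 _)) /=.
rewrite (negPf (lead0 _)) ?(negPf (cofactor_neq0 _ _)) //=; first by move/eqP.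
exact: node_itv.
Qed.

(** A zero of order exactly [n - 1] at [xi 1] turns the boundary term there into a fixed nonzero
    multiple of the solution's value. The two adjacent pieces contribute with opposite signs. *)
Lemma no_jump_at_first_node G : local_solutions D p xi f G -> (0 < p)%N ->
  G 0 0 (xi 1) = G 1 0 (xi 1).
Proof.
move=> GP p_gt0.
have msn : (n.-1 + 0).+1 = n by rewrite addn0 prednK.
have en : (n.-1 < n)%N by rewrite prednK.
have p1 : (1 < p.+2)%N by [].
have := sum_boundary_form GP (size_test_poly p1 en).
rewrite (bigD1 ord0) //= (bigD1 (Ordinal (p_gt0 : (1 < p.+1)%N))) //=.
rewrite big1 => [|j /andP[]]; last first.
  rewrite -!(inj_eq val_inj) /= => j0 j1; have jp := ltn_ord j.
  by rewrite !boundary_form_other_node ?subrr //=; lia.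
rewrite addr0 (boundary_form_other_node (G 0) _ (l := 0)) //.
rewrite (boundary_form_other_node (G 1) _ (l := 2)) //.
rewrite sub0r subr0 /node_poly !(boundary_form_lead _ msn) // addrC => /eqP.
rewrite subr_eq0 => /eqP /mulfI; rewrite signr_eq0 => /(_ isT) /mulfI.
rewrite !mulf_eq0 !pnatr_eq0 (gtn_eqF (fact_gt0 _)) /=.
rewrite (negPf (lead0 _)) ?(negPf (cofactor_neq0 _ _)) // ?node_itv //.
by move=> /(_ isT).
Qed.

(** By continuity, the values of the two extensions at [xi 1] are the one-sided limits of [f], which
    differ at a jump. *)
Lemma jump_left_right_neq G : local_solutions D p xi f G -> (0 < p)%N ->
  G 0 0 (xi 1) != G 1 0 (xi 1).
Proof.
move=> GP p_gt0; have [_ _ _ /(_ 1) jump _] := sol.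
have {jump} [l [r [fl fr lr]]] := jump p_gt0.
have [G0f [cG0 _] _] := GP 0 (leq0n _); have [G1f [cG1 _] _] := GP 1 p_gt0.
have lt01 := ltxi (leq0n p); have lt12 := ltxi p_gt0.
have [_ _ G0l] := (continuous_within_itvP _ lt01).1 (cG0 0 (leq0n _)).
have [_ G1r _] := (continuous_within_itvP _ lt12).1 (cG1 0 (leq0n _)).
have -> : G 0 0 (xi 1) = l.
  apply: (cvg_unique _ _ fl) => //; apply: cvg_trans G0l; apply: near_eq_cvg.
  near=> x; apply: G0f; rewrite in_itv /=; apply/andP; split; near: x.
    exact: nbhs_left_gt.
  exact: nbhs_left_lt.
have -> // : G 1 0 (xi 1) = r.
apply: (cvg_unique _ _ fr) => //; apply: cvg_trans G1r; apply: near_eq_cvg.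
near=> x; apply: G1f; rewrite in_itv /=; apply/andP; split; near: x.
  exact: nbhs_right_gt.
exact: nbhs_right_lt.
Unshelve. all: by end_near. Qed.

Lemma moments0_vanishes_off : vanishes_off a b p xi f.
Proof.
have [G GP] := exists_local_solutions.
have p0 : p = 0%N.
  apply/eqP; rewrite -leqn0 leqNgt; apply/negP => p_gt0.
  by have := jump_left_right_neq GP p_gt0; rewrite no_jump_at_first_node // eqxx.
have [G0f tG ode] := GP 0 (leq0n _).
have xi1 : xi 1 = b by rewrite -bE p0.
move=> x xab off; have xa := off 0 isT; have xb := off p.+1 (leqnn _).
have xI : x \in `[xi 0, xi 1] by rewrite aE xi1.
rewrite -G0f.
  apply: (ode_unique tG ode) xI n_gt0 => [y|i]; last exact: initial_values0.
  by move=> /(itv_node (leq0n _)); exact: lead0.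
move: xab; rewrite !in_itv /= xi1 !lt_neqAle eq_sym -bE -aE => /andP[-> ->].
by rewrite !andbT; apply/andP; split; apply/eqP.
Qed.

End PiecewiseSolution.

(** * Comparison of two subdivisions, and the bound *)

(** Off its nodes [xi], [f] is continuous; near such a point it is zero except at finitely many
    points, so its value there is the limit zero. *)
Lemma vanishes_off_indep (R : realType) (a b : R) (D : diffop R)
    (p p' : nat) (xi xi' : nat -> R) (f : R -> R) :
  piecewise_sol a b D p xi f -> vanishes_off a b p' xi' f ->
  vanishes_off a b p xi f.
Proof.
move=> sol off' x xab off.
have [_ [aE bE] ltxi _ loc] := sol.
have [j jp xj] : exists2 j, (j <= p)%N & x \in `]xi j, xi j.+1[.
  (* The least index of a node beyond [x] marks the right end of the piece containing [x]. *)
  have : (exists j, (j <= p.+1)%N && (x < xi j)).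
    exists p.+1; rewrite leqnn bE lt_neqAle; move: xab; rewrite in_itv /=.
    by move=> /andP[_ ->]; rewrite andbT -bE; apply/eqP/off.
  move=> ex; have [[|j] /andP[jp xj] jmin] := ex_minnP ex.
    by move: xj xab; rewrite aE in_itv /= => xa /andP[]; rewrite leNgt xa.
  exists j => //; rewrite in_itv /= xj andbT lt_neqAle eq_sym.
  apply/andP; split; first by apply/eqP/off; exact: ltnW.
  rewrite leNgt; apply/negP => xj'.
  by have := jmin j; rewrite xj' ltnn (ltnW jp) /= => /(_ isT).
have [g [gf [cg _] _]] := loc j jp.
have fx : f y @[y --> x^'] --> f x.
  have cgx : {for x, continuous (g 0%N)}.
    have [cgi _ _] := (continuous_within_itvP _ (ltxi j jp)).1 (cg 0%N (leq0n _)).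
    exact: cgi.
  have := (continuous_withinNx _ _).1 cgx; rewrite gf //; apply: cvg_trans.
  apply: near_eq_cvg; apply: nbhs_dnbhs; near=> y; apply: gf.
  by near: y; exact: near_in_itvoo.
have f0 : f y @[y --> x^'] --> (0 : R).
  apply: cvg_near_cst.
  (* The neighbourhoods are punctured because [x] may itself be one of the nodes [xi']. *)
  have avoid m : \forall y \near x^', forall i, (i < m)%N -> y <> xi' i.
    elim: m => [|m IHm]; first by near=> y.
    have xm : \forall y \near x^', y <> xi' m.
      have [->|xm] := eqVneq x (xi' m).
        by near=> y; apply/eqP; near: y; exact: nbhs_dnbhs_neq.
      have : nbhs x [set y | y != xi' m].
        by apply: open_nbhs_nbhs; split; [exact: open_neq | exact: xm].
      by move=> /nbhs_dnbhs; apply: filterS => y /eqP.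
    apply: filterS2 IHm xm => y yIH ym i.
    by rewrite ltnS leq_eqVlt => /orP[/eqP ->|/yIH].
  have nab : \forall y \near x^', y \in `[a, b].
    apply: nbhs_dnbhs; near=> y; apply: (itv_node sol jp).
    by apply: subset_itv_oo_cc; near: y; exact: near_in_itvoo.
  by apply: filterS2 nab (avoid p'.+2) => y yab yxi; exact: off'.
exact: cvg_unique fx f0.
Unshelve. all: by end_near. Qed.

Lemma size_coef_alpha (R : realType) (D : diffop R) (d : nat) :
  alpha D = (d%:Z)%:E ->
  forall j : 'I_(Defs.order D).+1, (size (coef j) <= d + j + 1)%N.
Proof.
move=> alphaD j; have := le_bigmax -oo%E
  (fun j : 'I_(Defs.order D).+1 => (degree (coef j) - (j%:Z)%:E)%E) j.
rewrite -/(alpha D) alphaD /degree.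
case: eqP => [->|_]; first by rewrite size_poly0.
by rewrite -EFinB lee_fin; move: (size _) => m; lia.
Qed.

Theorem corollary3 (R : realType) (a b : R) (hab : a < b) (n d p : nat)
  (hn : (0 < n)%N) (hd : (0 < d)%N) :
  (sigma_family a b (F1 a b n p d) <= (((p + 2) * n + d)%:R - 1)%:E)%E.
Proof.
apply: ge_ereal_sup => s [D [q [PDF ->]]]; rewrite /sigma.
case: ifPn => _.
  by rewrite lee_fin subr_ge0 ler1n addn_gt0 hd orbT.
(* [sigma] adds one to the supremum, so each order [k] is to be bounded by [(p + 2) * n + d - 2]. *)
have -> : (((p + 2) * n + d)%:R - 1)%:E =
    ((((p + 2) * n + d)%:R - 2)%:E + 1 :> \bar R)%E.
  by rewrite -EFinD; congr EFin; lra.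
apply: leeD2r; apply: ge_ereal_sup => _ [k [f [xi [sol nonzero mom]]] <-].
(* The inclusion provides a second operator and subdivision for [f], with the prescribed [n], [p]
   and [d]; the argument runs on these, as [D] and [q] are not controlled. *)
have [D' [orderD' alphaD' lead0 [xi' sol']]] : F1 a b n p d f.
  by apply: PDF; exists xi.
rewrite lee_fin lerBrDr -natrD ler_nat leqNgt; apply/negP => large.
apply/nonzero/(vanishes_off_indep sol).
apply: (moments0_vanishes_off sol' _ lead0 (size_coef_alpha alphaD') mom).
  by rewrite orderD'.
by rewrite orderD'; rewrite [(k + 2)%N]addn2 ltnS in large.
Qed.
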